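(* Consider Schmidt's game on $\mathbb{R}$ with the usual metric. For $x\in\mathbb{R}$ and $j\in\{0,1\}$ let $d^+(x,j)$ and $d^-(x,j)$ be the upper and lower frequencies of the digit $j$ in the binary expansion of $x$. Then the set $$\{x\in\mathbb{R} : 0<d^-(x,j)\le d^+(x,j)<1\text{ for } j\in\{0,1\}\}$$ is winning, but for all $\varepsilon>0$ and $j\in\{0,1\}$ the sets $\{x\in\mathbb{R} : \varepsilon<d^+(x,j)\}$ and $\{x\in\mathbb{R} : d^-(x,j)<1-\varepsilon\}$ are not winning.
   Context: **Schmidt's game.** Let $(Y,\rho)$ be a complete metric space and $0<\alpha,\beta<1$. The $(\alpha,\beta)$-game between Alice and Bob: Bob first chooses $r_0>0$ and $x_0\in Y$. Put $r_n=(\alpha\beta)^n r_0$. For $n=1,2,\dots$: Alice chooses $y_n\in Y$ with $\rho(x_{n-1},y_n)+\alpha r_{n-1}\le r_{n-1}$; then Bob chooses $x_n\in Y$ with $\rho(y_n,x_n)+\alpha\beta r_{n-1}\le \alpha r_{n-1}$. The closed balls $B_n=B(x_n,r_n)$ and $A_n=B(y_n,\alpha r_{n-1})$ satisfy $B_0\supseteq A_1\supseteq B_1\supseteq A_2\supseteq\cdots$ and intersect in a unique point, called the outcome. A set $S\subseteq Y$ is $(\alpha,\beta)$-winning if Alice has a strategy guaranteeing that the outcome lies in $S$; it is $\alpha$-winning if it is $(\alpha,\beta)$-winning for all $0<\beta<1$; it is winning if it is $\alpha$-winning for some $0<\alpha<1$. **Binary expansions and digit frequencies.** Write $x=x_0.x_1x_2\dots\in\mathbb{R}$,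 where $x_0$ is an integer and $x_i\in\{0,1\}$ ($i\ge1$) are the digits in the (infinite) binary expansion of the fractional part of $x$, i.e. $x=x_0+\sum_{i\ge1}x_i2^{-i}$; when the expansion is not unique, the lexicographically maximal one is taken (e.g. $1=1.000\dots$). For $j\in\{0,1\}$, $$d^+(x,j)=\limsup_{k\to\infty}\frac{\#\{1\le i\le k : x_i=j\}}{k},\qquad d^-(x,j)=\liminf_{k\to\infty}\frac{\#\{1\le i\le k : x_i=j\}}{k}.$$ *)

(* Defs.v *)
From HB Require Import structures.
From mathcomp Require Import all_boot all_order all_algebra.
From mathcomp Require Import all_classical all_reals all_analysis.

Set Implicit Arguments.
Unset Strict Implicit.
Unset Printing Implicit Defensive.

Import Order.TTheory GRing.Theory Num.Theory.
Import numFieldNormedType.Exports.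

Local Open Scope classical_set_scope.
Local Open Scope ring_scope.

Section SchmidtGame.
Context {R : realType} {Y : metricType R}.

(* In a general metric space this may be larger than the library's
   [closed_ball], which is the closure of the open ball. *)
Definition cball (c : Y) (r : R) : set Y := [set z | mdist c z <= r].

Section Play.
Variables (alpha beta r0 : R).

Definition radius (n : nat) : R := (alpha * beta) ^+ n * r0.

(* A play is given by Bob's centres x_0, x_1, ... and Alice's centres
   y_1, y_2, ...; the value y 0 is never used. *)
Variables (x y : nat -> Y).

Definition alice_legal (n : nat) : Prop :=
  mdist (x n) (y n.+1) + alpha * radius n <= radius n.

Definition bob_legal (n : nat) : Prop :=
  mdist (y n.+1) (x n.+1) + alpha * beta * radius n <= alpha * radius n.

Definition is_outcome (z : Y) : Prop :=
  \bigcap_n (cball (x n) (radius n) `&` cball (y n.+1) (alpha * radius n))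
    = [set z].

End Play.

(* y_n is computed from r_0 and Bob's centres [:: x_0; ...; x_{n-1}];
   Alice's own earlier moves are determined by these data. *)
Definition strategy : Type := R -> seq Y -> Y.

(* Alice has to answer legally as long as Bob has played legally so far; if Bob
   plays legally forever, the outcome has to lie in S. *)
Definition wins_with (alpha beta : R) (S : set Y) (s : strategy) : Prop :=
  forall (r0 : R) (x : nat -> Y), 0 < r0 ->
    let y := fun n => s r0 (mkseq x n) in
    (forall n, (forall m, (m < n)%N -> bob_legal alpha beta r0 x y m) ->
       alice_legal alpha beta r0 x y n) /\
    ((forall n, bob_legal alpha beta r0 x y n) ->
       exists2 z, is_outcome alpha beta r0 x y z & S z).

Definition alpha_beta_winning (alpha beta : R) (S : set Y) : Prop :=
  exists s : strategy, wins_with alpha beta S s.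

Definition alpha_winning (alpha : R) (S : set Y) : Prop :=
  forall beta, 0 < beta < 1 -> alpha_beta_winning alpha beta S.

Definition winning (S : set Y) : Prop :=
  exists2 alpha, 0 < alpha < 1 & alpha_winning alpha S.

End SchmidtGame.

Section BinaryDigits.
Context {R : realType}.
Implicit Types (x : R) (s t : nat -> int).

(* s 0 is the integer x_0 and s 1, s 2, ... are the binary digits. *)
Definition binary_expansion x s : Prop :=
  (forall i, s i.+1 \in [:: 0; 1]) /\
  (series (fun i => (s i)%:~R / 2 ^+ i : R) @ \oo --> x).

Definition lex_le s t : Prop :=
  s = t \/ exists n, (forall i, (i < n)%N -> s i = t i) /\ s n < t n.

(* Every real has exactly one lexicographically maximal expansion, so the
   default value of [xget] is never taken. *)
Definition digits x : nat -> int :=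
  xget (fun=> 0) [set s | binary_expansion x s /\
                          forall t, binary_expansion x t -> lex_le t s].

Definition digit_ratio x (j k : nat) : R :=
  (count (fun i => digits x i == j%:Z) (iota 1 k))%:R / k%:R.

Definition upper_freq x (j : nat) : R := limn_sup (digit_ratio x j).
Definition lower_freq x (j : nat) : R := limn_inf (digit_ratio x j).

End BinaryDigits.

(* Main.v *)
Require Import Defs.
From mathcomp Require Import all_boot all_order all_algebra.
From mathcomp Require Import all_classical all_reals all_analysis.
From mathcomp Require Import ring lra zify.

Import Order.TTheory GRing.Theory Num.Theory.
Import numFieldNormedType.Exports.

Local Open Scope classical_set_scope.
Local Open Scope ring_scope.

(* The digits of x are read off floor (2 ^ k * x).
   For the first set Alice plays with alpha = 1/16: a ball of radius r around x
   contains a dyadic interval of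
   length comparable to r, and in it a ball of radius r / 16 on which the next
   two binary digits are 0 and 1.  Hence both digits occur in every window of
   late digits whose length exceeds a bound depending on alpha * beta only.
   For the other sets Bob chooses alpha * beta = 2 ^ -L with L large: Alice's
   ball contains a dyadic interval that is C digits deeper than Bob's previous
   ball, where 2 ^ -C <= alpha, and there Bob prescribes all but two of the
   remaining L - C digits of the turn.  The other digit then has upper frequency
   at most 2 (C + 2) / L. *)

(** * Binary digits as differences of floors *)

Section FloorDigits.
Context {R : realType}.
Implicit Types (x y z : R) (a : int) (s : nat -> int).

Definition floor_digits x (i : nat) : int :=
  if i is k.+1 then Num.floor (2 ^+ k.+1 * x) - 2 * Num.floor (2 ^+ k * x)
  else Num.floor x.

Lemma floor_double y : Num.floor (2 * y) - 2 * Num.floor y \in [:: 0; 1].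
Proof.
have /andP[le_y y_lt] := floor_itv y.
rewrite !inE subr_eq add0r subr_eq !floor_eq !rmorphD !rmorphM /=.
rewrite rmorphD /= in y_lt.
by case: (ltP (2 * y) (2 * (Num.floor y)%:~R + 1)) => h;
  apply/orP; [left|right]; apply/andP; split; lra.
Qed.

(** The partial sum up to index n scaled by 2 ^ n (Horner's scheme), so that expansions are compared
    on integers. *)
Fixpoint prefix_int s (n : nat) : int :=
  if n is k.+1 then 2 * prefix_int s k + s k.+1 else s 0%N.

Lemma series_prefix_int s n :
  series (fun i => (s i)%:~R / 2 ^+ i : R) n.+1 = (prefix_int s n)%:~R / 2 ^+ n.
Proof.
elim: n => [|n IHn]; first by rewrite /series /= big_nat1.
rewrite /series /= big_nat_recr //= -[X in X + _]/(series _ n.+1) IHn.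
rewrite rmorphD rmorphM /= exprS; field.
by rewrite expf_neq0.
Qed.

Lemma prefix_int_floor_digits x n :
  prefix_int (floor_digits x) n = Num.floor (2 ^+ n * x).
Proof.
elim: n => [|n IHn]; first by rewrite /= expr0 mul1r.
by rewrite /= IHn addrC subrK.
Qed.

(* Only the partial sums from index 1 on are known to increase: s 0 may be
   negative. *)
Lemma prefix_int_le_floor x s n :
  binary_expansion x s -> prefix_int s n <= Num.floor (2 ^+ n * x).
Proof.
case=> sdig cvg_s; rewrite floor_ge_int -ler_pdivrMl ?exprn_gt0 // mulrC.
set u := series _ in cvg_s.
have u_nd : nondecreasing_seq (fun k => u k.+1).
  apply/nondecreasing_seqP => k; rewrite /u /series /= [leRHS]big_nat_recr //=.
  rewrite lerDl divr_ge0 ?exprn_ge0 // ler0z.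
  by have := sdig k; rewrite !inE => /orP[] /eqP ->.
have cvg_uS : (fun k => u k.+1) @ \oo --> x by rewrite cvg_shiftS.
rewrite -series_prefix_int -/u -(cvg_lim _ cvg_uS) //.
by apply: (nondecreasing_cvgn_le u_nd); apply/cvg_ex; exists x.
Qed.

Lemma binary_expansion_floor_digits x : binary_expansion x (floor_digits x).
Proof.
split=> [i|].
  by rewrite /floor_digits exprS -mulrA; exact: floor_double.
rewrite -cvg_shiftS /=.
(* The partial sum up to index n is floor (2 ^ n * x) / 2 ^ n, squeezed between x - 2 ^ -n and x. *)
have lim0 : (fun n => x - (2^-1) ^+ n : R) @ \oo --> x.
  rewrite -[X in _ --> X]subr0; apply: cvgB; first exact: cvg_cst.
  by apply: cvg_expr; rewrite ger0_norm; lra.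
apply: (squeeze_cvgr _ lim0 (cvg_cst x)); apply: nearW => n.
rewrite series_prefix_int prefix_int_floor_digits exprVn.
have p0 : 0 < 2 ^+ n :> R by rewrite exprn_gt0.
have /andP[] := floor_itv (2 ^+ n * x); rewrite rmorphD /= => h1 h2.
rewrite ler_pdivrMr // ler_pdivlMr // mulrBl mulVf ?gt_eqF //.
by rewrite ![x * _]mulrC; apply/andP; split; lra.
Qed.

(** At the first index n where s differs from the floor digits the shorter prefixes agree, so
    [prefix_int_le_floor] at n compares the n-th entries alone. *)
Lemma floor_digits_max x s :
  binary_expansion x s -> lex_le s (floor_digits x).
Proof.
move=> xs; have [|/existsNP ex_ne] := pselect (forall n, s n = floor_digits x n).
  by left; apply/funext.
right; have {ex_ne} : exists n, s n != floor_digits x n.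
  by case: ex_ne => n /eqP; exists n.
case/ex_minnP=> n ne_n min_n; exists n.
have eq_lt i : (i < n)%N -> s i = floor_digits x i.
  by move=> lt_in; apply/eqP; apply: contraLR lt_in => /min_n; rewrite -leqNgt.
split=> //; rewrite lt_neqAle ne_n /=.
have eq_prefix k : (k < n)%N -> prefix_int s k = prefix_int (floor_digits x) k.
  elim: k => [|k IHk] lt_kn /=; first exact: eq_lt.
  by rewrite IHk ?(ltnW lt_kn) // (eq_lt k.+1).
have := prefix_int_le_floor x s n xs; rewrite -prefix_int_floor_digits.
case: n eq_prefix {ne_n min_n eq_lt} => [|n] eq_prefix //=.
by rewrite eq_prefix // lerD2l.
Qed.

Lemma lex_le_anti s t : lex_le s t -> lex_le t s -> s = t.
Proof.
case=> [//|[m [eqm ltm]]] [//|[n [eqn ltn]]]; exfalso.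
case: (ltngtP m n) => [lt_mn|lt_nm|eq_mn].
- by move: ltm; rewrite (eqn _ lt_mn) ltxx.
- by move: ltn; rewrite (eqm _ lt_nm) ltxx.
- by move: ltm; rewrite eq_mn => /(lt_trans ltn); rewrite ltxx.
Qed.

Lemma digitsE x : digits x = floor_digits x.
Proof.
have max_fd : [set s | binary_expansion x s /\
    forall t, binary_expansion x t -> lex_le t s] (floor_digits x).
  by split; [exact: binary_expansion_floor_digits|exact: floor_digits_max].
apply: xget_unique => // s [xs max_s]; apply: lex_le_anti.
  exact: floor_digits_max.
exact/max_s/binary_expansion_floor_digits.
Qed.

(** The floors of 2 ^ (m + k) * z are 2 ^ k * a for k <= N, so each is exactly twice its
    predecessor. *)
Lemma digits_run0 z m N a i :
    a%:~R <= 2 ^+ m * z < a%:~R + (2 ^+ N)^-1 -> (i < N)%N ->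
  digits z (m + i).+1 = 0.
Proof.
move=> /andP[az za] lt_iN; rewrite digitsE /=.
have run k : (k <= N)%N -> Num.floor (2 ^+ (m + k) * z) = 2 ^+ k * a.
  move=> le_kN; apply: floor_def; rewrite rmorphD /=.
  have -> : (2 ^+ k * a)%:~R = 2 ^+ k * a%:~R :> R by rewrite rmorphM rmorphXn.
  have p0 : 0 < 2 ^+ k :> R by rewrite exprn_gt0.
  rewrite exprD [_ * 2 ^+ k]mulrC -[2 ^+ k * _ * z]mulrA ler_pM2l // az /=.
  rewrite -(ltr_pM2l p0) in za; apply: (lt_le_trans za).
  rewrite mulrDr lerD2l ler_pdivrMr ?exprn_gt0 // mul1r.
  by apply: ler_weXn2l; rewrite ?ler1n.
by rewrite -addnS !run ?(ltnW lt_iN) // exprS; ring.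
Qed.

(** Here the floors are 2 ^ k * (a + 1) - 1, each twice its predecessor plus one. *)
Lemma digits_run1 z m N a i :
    a%:~R + 1 - (2 ^+ N)^-1 <= 2 ^+ m * z < a%:~R + 1 -> (i < N)%N ->
  digits z (m + i).+1 = 1.
Proof.
move=> /andP[az za] lt_iN; rewrite digitsE /=.
have run k : (k <= N)%N -> Num.floor (2 ^+ (m + k) * z) = 2 ^+ k * (a + 1) - 1.
  move=> le_kN; apply: floor_def; rewrite subrK rmorphB /=.
  have -> : (2 ^+ k * (a + 1))%:~R = 2 ^+ k * (a%:~R + 1) :> R.
    by rewrite rmorphM rmorphXn /= [(a + 1)%:~R]rmorphD.
  have p0 : 0 < 2 ^+ k :> R by rewrite exprn_gt0.
  rewrite exprD [_ * 2 ^+ k]mulrC -[2 ^+ k * _ * z]mulrA ltr_pM2l // za andbT.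
  rewrite -(ler_pM2l p0) in az; apply: le_trans az.
  rewrite mulrBr lerB // ler_pdivrMr ?exprn_gt0 // mul1r.
  by apply: ler_weXn2l; rewrite ?ler1n.
by rewrite -addnS !run ?(ltnW lt_iN) // exprS; ring.
Qed.

End FloorDigits.

(** * Counting positions in recurrent and periodic patterns *)

Section Counting.
Implicit Types (P : pred nat) (C D K L : nat).

Lemma iota1_add m n : iota 1 (m + n) = iota 1 m ++ iota m.+1 n.
Proof. by rewrite iotaD add1n. Qed.

Lemma count_recurrent P K D :
    (forall t, (K <= t)%N -> exists2 i, (t < i <= t + D)%N & P i) ->
  forall q, (q <= count P (iota 1 (K + q * D)))%N.
Proof.
move=> recP; elim=> [//|q IHq].
rewrite mulSn addnCA addnC iota1_add count_cat -addn1 leq_add // -has_count.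
have [i Hi Pi] := recP (K + q * D)%N (leq_addr _ _).
by apply/hasP; exists i => //; rewrite mem_iota addSn ltnS.
Qed.

(** Only the initial K positions and an incomplete last window are lost, together at most K + D <= k
    / 2. *)
Lemma count_recurrent_linear P K D :
    (forall t, (K <= t)%N -> exists2 i, (t < i <= t + D)%N & P i) ->
  forall k, (2 * (K + D) <= k)%N -> (k <= 2 * D * count P (iota 1 k))%N.
Proof.
move=> recP k le_k.
have D0 : (0 < D)%N by have [i] := recP K (leqnn K); lia.
pose q := ((k - K) %/ D)%N.
have /andP[le_qD lt_qD] : (q * D <= k - K < q.+1 * D)%N.
  by rewrite leq_divM ltn_ceil.
have : (q <= count P (iota 1 k))%N.
  have le_qk : (K + q * D <= k)%N by lia.
  by rewrite -(subnKC le_qk) iota1_add count_cat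
    (leq_trans (count_recurrent _ _ _ recP q)) // leq_addr.
by nia.
Qed.

(** In each block of length L only the first C and the last L - D positions can violate P. *)
Lemma count_periodic_gaps P C D L :
    (C <= D <= L)%N ->
    (forall n i, (C <= i < D)%N -> P (n * L + i).+1) ->
  forall n, (count (predC P) (iota 1 (n * L)) <= n * (C + (L - D)))%N.
Proof.
move=> /andP[le_CD le_DL] HP; elim=> [//|n IHn].
rewrite mulSn addnC iota1_add count_cat mulSn addnC leq_add //.
rewrite [X in iota _ X](_ : L = (C + ((D - C) + (L - D)))%N); last lia.
rewrite 2!iotaD !count_cat.
rewrite leq_add //.
  by apply: leq_trans (count_size _ _) _; rewrite size_iota.
rewrite -[leqRHS]add0n leq_add //; last first.
  by apply: leq_trans (count_size _ _) _; rewrite size_iota.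
rewrite leqNgt -has_count; apply/hasPn => k.
rewrite mem_iota /= negbK => Hk.
have -> : k = (n * L + (k.-1 - n * L)).+1 by lia.
by apply: HP; lia.
Qed.

(** Rounding k up to a whole number of blocks costs at most a factor 2, since L <= k. *)
Lemma count_periodic_gaps_linear P C D L :
    (C <= D <= L)%N -> (0 < L)%N ->
    (forall n i, (C <= i < D)%N -> P (n * L + i).+1) ->
  forall k, (L <= k)%N ->
    (count (predC P) (iota 1 k) * L <= 2 * (C + (L - D)) * k)%N.
Proof.
move=> CDL L0 HP k le_Lk.
pose q := (k %/ L)%N.
have /andP[le_qL lt_qL] : (q * L <= k < q.+1 * L)%N by rewrite leq_divM ltn_ceil.
have : (count (predC P) (iota 1 k) <= q.+1 * (C + (L - D)))%N.
  apply: leq_trans (count_periodic_gaps _ _ _ _ CDL HP q.+1).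
  by rewrite -(subnKC (ltnW lt_qL)) iota1_add count_cat leq_addr.
by nia.
Qed.

End Counting.

(** * Upper and lower digit frequencies *)

Section Frequencies.
Context {R : realType}.

(** Boundedness makes the suprema and infima of tails genuine and their limits exist, so eventual
    bounds on u pass to the limits. *)
Lemma le_limn_inf_sup (u : R^nat) a b :
    (forall n, 0 <= u n <= 1) -> (\forall n \near \oo, a <= u n <= b) ->
  [/\ a <= limn_inf u, limn_inf u <= limn_sup u & limn_sup u <= b].
Proof.
move=> u01 [N _ uab].
have ub : has_ubound (range u) by exists 1 => _ [n _ <-]; case/andP: (u01 n).
have lb : has_lbound (range u) by exists 0 => _ [n _ <-]; case/andP: (u01 n).
have cs : cvgn (sups u) by apply: cvgP; exact: cvg_sups_inf.
have ci : cvgn (infs u) by apply: cvgP; exact: cvg_infs_sup.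
split.
- apply: limr_ge => //; exists N => // n /= Nn.
  apply: lb_le_inf; first by exists (u n); exists n => /=.
  by move=> _ [m /= nm <-]; have /andP[] := uab m (leq_trans Nn nm).
- apply: ler_lim => //; apply: nearW => n; apply: (@le_trans _ _ (u n)).
    by apply: ge_inf; [exact: has_lbound_sdrop|exists n => /=].
  by apply: ub_le_sup; [exact: has_ubound_sdrop|exists n => /=].
- apply: limr_le => //; exists N => // n /= Nn.
  apply: ge_sup; first by exists (u n); exists n => /=.
  by move=> _ [m /= nm <-]; have /andP[] := uab m (leq_trans Nn nm).
Qed.

Lemma digit_ratio_itv (x : R) j k : 0 <= digit_ratio x j k <= 1.
Proof.
(* At k = 0 the ratio is 0, because the inverse of 0 is 0. *)
rewrite /digit_ratio; case: k => [|k]; first by rewrite invr0 mulr0 lexx ler01.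
rewrite divr_ge0 // ler_pdivrMr ?ltr0n // mul1r ler_nat.
by rewrite (leq_trans (count_size _ _)) ?size_iota.
Qed.

Lemma digit_ratioC (x : R) (j k : nat) :
  (j < 2)%N -> (0 < k)%N -> digit_ratio x j k + digit_ratio x (1 - j) k = 1.
Proof.
move=> j2 k0; rewrite /digit_ratio -mulrDl -natrD.
rewrite -[X in (_ + X)%N](_ : count (predC (fun i => digits x i == j%:Z))
    (iota 1 k) = _).
  by rewrite count_predC size_iota divff // pnatr_eq0 -lt0n.
apply: eq_in_count => -[|i]; rewrite mem_iota //= => _.
rewrite digitsE; have := (binary_expansion_floor_digits x).1 i.
by rewrite !inE => /orP[] /eqP ->; case: j j2 => [|[]].
Qed.

(** Eventually each digit has ratio at least 1 / (2 D); this bound for the other digit keeps the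
    ratio of j away from 1. *)
Lemma recurrent_digits_freq (x : R) K D :
    (forall j t, (j < 2)%N -> (K <= t)%N ->
       exists2 i, (t < i <= t + D)%N & digits x i = j%:Z) ->
  forall j, (j < 2)%N ->
    [/\ 0 < lower_freq x j, lower_freq x j <= upper_freq x j &
        upper_freq x j < 1].
Proof.
move=> rec_x j j2.
have D0 : (0 < D)%N by have [i] := rec_x 0%N K isT (leqnn K); lia.
have c0 : 0 < (2 * D)%:R^-1 :> R by rewrite invr_gt0 ltr0n muln_gt0.
have low j' k : (j' < 2)%N -> (2 * (K + D) <= k)%N ->
    (2 * D)%:R^-1 <= digit_ratio x j' k.
  move=> j'2 le_k; rewrite /digit_ratio ler_pdivlMr ?ltr0n; last lia.
  rewrite mulrC ler_pdivrMr ?ltr0n ?muln_gt0 // -natrM ler_nat mulnC.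
  apply: count_recurrent_linear le_k => t /(rec_x _ _ j'2)[i Hi /eqP].
  by exists i.
have := le_limn_inf_sup (digit_ratio x j) (2 * D)%:R^-1 (1 - (2 * D)%:R^-1)
  (digit_ratio_itv x j).
case=> [|h1 h2 h3]; first exists (2 * (K + D))%N => // k /= le_k.
  rewrite low //=; have := low (1 - j)%N k ltac:(lia) le_k.
  by have := digit_ratioC x j k j2 ltac:(lia); lra.
split=> //; first exact: lt_le_trans c0 h1.
by apply: le_lt_trans h3 _; lra.
Qed.

(** The other digit can occur only in the gaps of the blocks, so its ratio is eventually at most
    eps; [digit_ratioC] turns this into the bound for j. *)
Lemma dense_digit_freq (x : R) (j C D L : nat) (eps : R) :
    (j < 2)%N -> (C <= D <= L)%N -> (0 < L)%N ->
    (2 * (C + (L - D)))%:R <= eps * L%:R ->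
    (forall n i, (C <= i < D)%N -> digits x (n * L + i).+1 = j%:Z) ->
  1 - eps <= lower_freq x j /\ upper_freq x (1 - j) <= eps.
Proof.
move=> j2 CDL L0 le_eps run.
have up k : (L <= k)%N -> digit_ratio x (1 - j) k <= eps.
  move=> le_Lk; have k0 : (0 < k)%N by lia.
  rewrite /digit_ratio ler_pdivrMr ?ltr0n // -(@ler_pM2r _ L%:R) ?ltr0n //.
  apply: (@le_trans _ _ ((2 * (C + (L - D)))%:R * k%:R)); last first.
    by rewrite mulrAC ler_wpM2r.
  rewrite -!natrM ler_nat.
  apply: leq_trans (count_periodic_gaps_linear
    (fun i => digits x i == j%:Z) _ _ _ CDL L0 _ k le_Lk).
    rewrite leq_pmul2r //; apply: sub_count => i /= /eqP ->.
    by case: j j2 {run} => [|[]].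
  by move=> n i /run ->.
split.
  have [|+ _ _] := le_limn_inf_sup (digit_ratio x j) (1 - eps) 1
    (digit_ratio_itv x j); last by [].
  exists L => // k /= le_Lk; have /andP[_ ->] := digit_ratio_itv x j k.
  rewrite andbT; have := digit_ratioC x j k j2 ltac:(lia).
  by have := up k le_Lk; lra.
have [|_ _ +] := le_limn_inf_sup (digit_ratio x (1 - j)) 0 eps
  (digit_ratio_itv x _); last by [].
exists L => // k /= le_Lk; have /andP[-> _] := digit_ratio_itv x (1 - j) k.
exact: up.
Qed.

End Frequencies.

(** * Outcomes of plays and replies in a single turn *)

Section Game.
Context {R : realType}.
Implicit Types (alpha beta r : R).

Lemma mulr_exp2VS m : 2 * 2 ^- m.+1 = 2 ^- m :> R.
Proof. by rewrite exprS invfM mulrA mulfV ?pnatr_eq0 // mul1r. Qed.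

Lemma exp2V_le (a : R) : 0 < a -> exists L, 2 ^- L <= a.
Proof.
move=> a0; exists (Num.bound a^-1).
rewrite -[leRHS]invrK lef_pV2 ?posrE ?invr_gt0 ?exprn_gt0 //.
exact/ltW/upper_nthrootP.
Qed.

Lemma dyadic_scale r : 0 < r <= 1 -> exists m, 2 ^- m <= r < 2 * 2 ^- m.
Proof.
move=> /andP[r0 r1].
have := exp2V_le r r0.
case/ex_minnP=> m le_r min_m; exists m; rewrite le_r /=.
case: m le_r min_m => [|m] _ min_m; first by rewrite expr0 invr1; lra.
rewrite mulr_exp2VS ltNge; apply/negP => /min_m.
by rewrite ltnn.
Qed.

Lemma radius_small alpha beta r d : 0 < alpha < 1 -> 0 < beta < 1 -> 0 < r ->
  0 < d -> exists n, Defs.radius alpha beta r n < d.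
Proof.
move=> a01 b01 r0 d0.
have /cvg_expr/cvgrPdist_lt/(_ (d / r)) : `|alpha * beta| < 1.
  by rewrite ger0_norm; nra.
rewrite divr_gt0 // => /(_ isT)[N _ /(_ N (leqnn N))] /=.
rewrite sub0r normrN => h; exists N.
by rewrite /Defs.radius -ltr_pdivlMr //; apply: le_lt_trans h; exact: ler_norm.
Qed.

(** Nested intervals: the supremum of the left endpoints lies in every ball, and it is the only such
    point because the radii tend to 0. *)
Lemma play_outcome alpha beta r (x y : nat -> R^o) :
    0 < alpha < 1 -> 0 < beta < 1 -> 0 < r ->
    (forall n, alice_legal alpha beta r x y n) ->
    (forall n, bob_legal alpha beta r x y n) ->
  exists z, is_outcome alpha beta r x y z.
Proof.
move=> a01 b01 r0 AL BL.
have rS n : Defs.radius alpha beta r n.+1 = alpha * beta * Defs.radius alpha beta r n.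
  by rewrite /Defs.radius exprS mulrA.
have rad0 n : 0 <= Defs.radius alpha beta r n.
  by rewrite mulr_ge0 ?exprn_ge0 ?ltW //; nra.
have distE (u v : R^o) : mdist u v = `|v - u| by [].
have stepA n (w : R^o) : cball (y n.+1) (alpha * Defs.radius alpha beta r n) w ->
    cball (x n) (Defs.radius alpha beta r n) w.
  have := AL n; rewrite /alice_legal /cball /= !distE !ler_norml -!lerBrDr.
  by rewrite !ler_norml; lra.
have stepB n (w : R^o) : cball (x n.+1) (Defs.radius alpha beta r n.+1) w ->
    cball (y n.+1) (alpha * Defs.radius alpha beta r n) w.
  have := BL n; rewrite /bob_legal /cball /= !distE -lerBrDr rS.
  by rewrite !ler_norml; lra.
have nested m n (w : R^o) : (n <= m)%N -> cball (x m) (Defs.radius alpha beta r m) w ->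
    cball (x n) (Defs.radius alpha beta r n) w.
  elim: m => [|m IHm]; first by rewrite leqn0 => /eqP ->.
  rewrite leq_eqVlt => /orP[/eqP -> //|]; rewrite ltnS => nm.
  by move/stepB/stepA; exact: IHm.
pose lo n : R := x n - Defs.radius alpha beta r n.
pose hi n : R := x n + Defs.radius alpha beta r n.
have lo_mem n : cball (x n) (Defs.radius alpha beta r n) (lo n : R^o).
  by rewrite /cball /= distE /lo ler_norml; have := rad0 n; lra.
have lohi m n : lo m <= hi n.
  have [nm|/ltnW mn] := leqP n m.
    have := nested _ _ _ nm (lo_mem m); rewrite /cball /= distE ler_norml /hi.
    by lra.
  have := nested _ _ (hi n : R^o) mn; rewrite /cball /= !distE /hi /lo.
  by rewrite !ler_norml; have := rad0 n; lra.
have lo_sup : has_sup (range lo).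
  by split; [exists (lo 0%N); exists 0%N|exists (hi 0%N) => _ [m _ <-]].
pose z : R^o := sup (range lo).
have zP n : cball (x n) (Defs.radius alpha beta r n) z.
  rewrite /cball /= distE ler_norml.
  have : lo n <= z by apply: ub_le_sup; [case: lo_sup|exists n].
  have : z <= hi n.
    by apply: ge_sup; [case: lo_sup|move=> _ [m _ <-]; exact: lohi].
  by rewrite /lo /hi; lra.
exists z; apply/seteqP; split=> [w wP|_ ->]; last first.
  by move=> n _; split; [exact: zP|exact/stepB/zP].
apply/eqP; rewrite -subr_eq0 -normr_eq0 eq_le normr_ge0 andbT leNgt.
apply/negP => wz0; have wz2 : 0 < `|w - z| / 2 by rewrite divr_gt0.
have [n] := radius_small alpha beta r _ a01 b01 r0 wz2.
have [wn _] := wP n I; move: wn (zP n); rewrite /cball /= !distE => h1 h2.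
have := ler_distD (x n) w z; rewrite [`|x n - z|]distrC; lra.
Qed.

(** A strategy sees the whole history, so the recursion builds the list of Bob's centres x_0, ...,
    x_n and reads off its last entry. *)
Lemma bob_play {Y : Type} (s : seq Y -> Y) (f : nat -> Y -> Y) (x0 : Y) :
  exists x, x 0%N = x0 /\ forall n, x n.+1 = f n (s (mkseq x n.+1)).
Proof.
pose h := fix h n :=
  if n is k.+1 then rcons (h k) (f k (s (h k))) else [:: x0].
pose x n := last x0 (h n).
have hE n : mkseq x n.+1 = h n.
  by elim: n => [|n IHn] //; rewrite mkseqS IHn /x /= last_rcons.
by exists x; split=> // n; rewrite hE /x /= last_rcons.
Qed.

(** Alice's move for alpha = 1/16. Digits are demanded only once r <= 1, where a scale 2 ^ -m with m
    natural is available. *)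
Definition pattern_reply (x r y : R) : Prop :=
  `|y - x| + r / 16 <= r /\
  (r <= 1 -> exists2 m, 2 ^- m <= r < 2 * 2 ^- m &
     forall z, `|z - y| <= r / 16 -> digits z m.+1 = 0 /\ digits z m.+2 = 1).

Lemma pattern_reply_ex (x r : R) : 0 < r -> exists y, pattern_reply x r y.
Proof.
move=> r0; have [r1|r1] := ltP 1 r.
  by exists x; split; [rewrite subrr normr0; lra|lra].
have [|m /andP[e_le e_gt]] := dyadic_scale r; first by rewrite r0.
have p0 : 0 < 2 ^+ m :> R by rewrite exprn_gt0.
set e : R := 2 ^- m in e_le e_gt.
have e0 : 0 < e by rewrite invr_gt0.
have eK u : 2 ^+ m * (u * e) = u by rewrite mulrC divfK // gt_eqF.
have [t xE] : exists t, x = t * e.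
  by exists (2 ^+ m * x); rewrite mulrAC divff ?mul1r // gt_eqF.
have /andP[le_t t_lt] := floor_itv t; rewrite rmorphD /= in t_lt.
set a := Num.floor t in le_t t_lt.
(* In units of e, the points whose next digits are 0, 1 fill [a + 1/4, a + 1/2), with midpoint a +
   3/8 and half-length 1/8; and r / 16 < e / 8. The centre moves by at most 5/8 e <= 5/8 r, and 5/8
   + 1/16 < 1. *)
exists ((a%:~R + 3 / 8) * e); split.
  rewrite xE -mulrBl normrM (gtr0_norm e0).
  have : `|a%:~R + 3 / 8 - t| <= 5 / 8 by rewrite ler_norml; lra.
  by move/(ler_wpM2r (ltW e0)); lra.
move=> _; exists m => [|z z_near]; first by rewrite e_le.
have [w zE] : exists w, z = w * e.
  by exists (2 ^+ m * z); rewrite mulrAC divff ?mul1r // gt_eqF.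
have : `|w - (a%:~R + 3 / 8)| < 1 / 8.
  rewrite -(ltr_pM2r e0) -[X in _ * X < _](gtr0_norm e0) -normrM mulrBl -zE.
  by apply: le_lt_trans z_near _; lra.
rewrite ltr_norml => w_near; split.
  rewrite -[X in digits _ X.+1]addn0; apply: (@digits_run0 R z m 1 a) => //.
  by rewrite zE eK expr1; lra.
rewrite -[X in digits _ X.+1]addn0.
apply: (@digits_run1 R z m.+1 1 (2 * a)) => //.
by rewrite zE [2 ^+ m.+1]exprS -mulrA eK expr1 rmorphM /=; lra.
Qed.

(** Bob's answer inside the ball of radius 2 ^ -m about Alice's centre y. Two digits beyond N are
    spent to keep his closed ball inside a half-open dyadic interval. *)
Lemma bob_reply_ex (j m N : nat) (y : R) : (j < 2)%N ->
  exists x, `|x - y| + 2 ^- (m + N + 2) <= 2 ^- m /\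
    forall z, `|z - x| <= 2 ^- (m + N + 2) ->
      forall i, (i < N)%N -> digits z (m + i).+1 = j%:Z.
Proof.
move=> j2.
have p0 : 0 < 2 ^+ m :> R by rewrite exprn_gt0.
have -> : 2 ^- (m + N + 2) = 2 ^- N / 4 * 2 ^- m :> R.
  rewrite -addnA exprD exprD invfM invfM mulrC; congr (_ * _ * _).
  by rewrite expr2 -natrM.
set e : R := 2 ^- m.
have e0 : 0 < e by rewrite invr_gt0.
have eK u : 2 ^+ m * (u * e) = u by rewrite mulrC divfK // gt_eqF.
set d : R := 2 ^- N.
have d0 : 0 < d by rewrite invr_gt0 exprn_gt0.
have d1 : d <= 1 by rewrite invf_le1 ?exprn_gt0 // exprn_ege1 // ler1n.
have [t yE] : exists t, y = t * e.
  by exists (2 ^+ m * y); rewrite mulrAC divff ?mul1r // gt_eqF.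
have /andP[le_t t_lt] := floor_itv t; rewrite rmorphD /= in t_lt.
set a := Num.floor t in le_t t_lt.
(* The midpoint of the first or last subinterval of length d of [a, a + 1), in units of e; radius d
   / 4 stays clear of the open right end. *)
pose c : R := a%:~R + (if j == 0%N then d / 2 else 1 - d / 2).
exists (c * e); split.
  rewrite yE -mulrBl normrM (gtr0_norm e0) -mulrDl -[leRHS]mul1r ler_pM2r //.
  have : `|c - t| <= 1 - d / 4; last by lra.
  by rewrite ler_norml /c; case: eqP => _; apply/andP; split; lra.
move=> z z_near i lt_iN.
have [w zE] : exists w, z = w * e.
  by exists (2 ^+ m * z); rewrite mulrAC divff ?mul1r // gt_eqF.
move: z_near.
rewrite zE -mulrBl normrM (gtr0_norm e0) ler_pM2r // ler_norml /c => w_near.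
case: j j2 c w_near => [|[|//]] _ c /= w_near.
  by apply: (@digits_run0 R _ m N a) => //; rewrite eK -/d; lra.
by apply: (@digits_run1 R _ m N a) => //; rewrite eK -/d; lra.
Qed.

End Game.

(** * Strategies of Alice and Bob over the whole game *)

Section Strategies.
Context {R : realType}.
Implicit Types (alpha beta eps : R).

Lemma ler_exp2V m n : (2 ^- m <= 2 ^- n :> R) = (n <= m)%N.
Proof. by rewrite lef_pV2 ?posrE ?exprn_gt0 // ler_eXn2l // ltr1n. Qed.

Lemma ltr_exp2V m n : (2 ^- m < 2 ^- n :> R) = (n < m)%N.
Proof. by rewrite ltf_pV2 ?posrE ?exprn_gt0 // ltr_eXn2l // ltr1n. Qed.

Lemma positive_freq_winning :
  winning [set x : R^o | forall j : 'I_2,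
    [/\ 0 < lower_freq (x : R) j,
        lower_freq (x : R) j <= upper_freq (x : R) j &
        upper_freq (x : R) j < 1]].
Proof.
exists 16^-1; first by lra.
move=> beta b01.
pose reply (x r : R) : R := xget 0 [set y | pattern_reply x r y].
have replyP x r : 0 < r -> pattern_reply x r (reply x r).
  by move=> r0; apply: xgetPex; exact: pattern_reply_ex.
have rad_gt0 r n : 0 < r -> 0 < Defs.radius 16^-1 beta r n.
  by move=> r0; rewrite mulr_gt0 ?exprn_gt0 //; nra.
(* The history xs is x_0, ..., x_n, so the current ball has index [(size xs).-1]; the default centre
   0 concerns only the empty history. *)
exists (fun r xs => reply (last 0 xs) (Defs.radius 16^-1 beta r (size xs).-1)).
move=> r x r0 y.
have yS n : y n.+1 = reply (x n) (Defs.radius 16^-1 beta r n).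
  by rewrite /y size_mkseq mkseqS last_rcons.
have AL n : alice_legal 16^-1 beta r x y n.
  have [+ _] := replyP (x n) _ (rad_gt0 r n r0).
  by rewrite /alice_legal yS mulrC.
split=> // BL.
have [||z zP] := play_outcome 16^-1 beta r x y _ _ r0 AL BL => //; first by lra.
exists z => // j.
have [K K_le] := exp2V_le r r0.
have ab0 : 0 < 16^-1 * beta by nra.
have [L L_le] := exp2V_le _ ab0.
apply: (recurrent_digits_freq z K.+1 L.+2) => // {}j t j2 le_Kt.
have t0 : 0 < 2 ^- t :> R by rewrite invr_gt0 exprn_gt0.
have : exists n, Defs.radius 16^-1 beta r n <= 2 ^- t.
  have [|n /ltW] := radius_small 16^-1 beta r (2 ^- t) _ b01 r0 t0; first by lra.
  by exists n.
(* Take the first ball of radius at most 2 ^ -t. One turn shrinks radii by a factor of at least 2 ^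
   -L, so its radius still exceeds 2 ^ -(L + t). *)
case/ex_minnP=> n le_t min_n.
have lt_n : 2 ^- (L + t) < Defs.radius 16^-1 beta r n.
  case: n le_t min_n => [|n] le_t min_n.
    (* The case n = 0 is impossible: r >= 2 ^ -K > 2 ^ -t, as t > K. *)
    move: le_t; rewrite /Defs.radius expr0 mul1r => /(le_trans K_le).
    by rewrite ler_exp2V leqNgt le_Kt.
  rewrite /Defs.radius exprS -mulrA -/(Defs.radius _ _ _ _) exprD invfM.
  apply: (@le_lt_trans _ _ (16^-1 * beta * 2 ^- t)).
    by rewrite ler_wpM2r // ltW.
  by rewrite ltr_pM2l // ltNge; apply/negP => /min_n; rewrite ltnn.
have le_1 : Defs.radius 16^-1 beta r n <= 1.
  by apply: le_trans le_t _; rewrite invf_le1 ?exprn_gt0 // exprn_ege1 // ler1n.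
have [_ /(_ le_1)[m /andP[m_le m_gt]]] := replyP (x n) _ (rad_gt0 r n r0).
(* Hence t <= m <= t + L, and the positions m + 1 and m + 2 carrying 0 and 1 fall in the window of
   length L + 2 after t. *)
have le_tm : (t <= m)%N by rewrite -ler_exp2V (le_trans m_le).
have le_mt : (m <= t + L)%N.
  have := lt_trans lt_n m_gt; case: m {m_le m_gt le_tm} => // m.
  by rewrite mulr_exp2VS ltr_exp2V addnC.
have itv1 : (t < m.+1 <= t + L.+2)%N by clear -le_tm le_mt; lia.
have itv2 : (t < m.+2 <= t + L.+2)%N by clear -le_tm le_mt; lia.
have : (\bigcap_n (cball (x n) (Defs.radius 16^-1 beta r n) `&`
    cball (y n.+1) (16^-1 * Defs.radius 16^-1 beta r n))) z by rewrite zP.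
move=> /(_ n I)[_]; rewrite /cball /= yS => z_near.
case/(_ z); first by rewrite [_ / 16]mulrC.
move=> d0 d1; case: j j2 => [|[|//]] _; first by exists m.+1.
by exists m.+2.
Qed.

(** Alice's strategy puts the outcome in S while Bob prescribes its digits, so any S won for this
    beta contains a point with few digits other than j. *)
Lemma bob_forces_digit alpha eps (j : nat) :
    0 < alpha < 1 -> 0 < eps -> (j < 2)%N ->
  exists2 beta, 0 < beta < 1 & forall S : set R^o,
    alpha_beta_winning alpha beta S ->
    exists2 z, S z &
      1 - eps <= lower_freq (z : R) j /\ upper_freq (z : R) (1 - j) <= eps.
Proof.
move=> /andP[a0 a1] e0 j2.
have [C C_le] := exp2V_le _ a0.
(* Large enough that the C + 2 positions per turn which Bob leaves free satisfy 2 (C + 2) <= eps *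
   L. *)
pose N := (Num.bound ((2 * (C + 2))%:R / eps)).+1.
pose L := (C + N + 2)%N.
have L_big : (2 * (C + 2))%:R <= eps * L%:R.
  rewrite -ler_pdivrMl // mulrC.
  apply: (@le_trans _ _ N%:R); last by rewrite ler_nat; lia.
  apply: ltW; apply: (@lt_trans _ _ (Num.bound ((2 * (C + 2))%:R / eps))%:R).
    by apply: archi_boundP; rewrite divr_ge0 // ltW.
  by rewrite ltr_nat.
(* This makes alpha * beta = 2 ^ -L, and beta < 1 because 2 ^ -L < 2 ^ -C <= alpha. *)
exists (2 ^- L / alpha).
  rewrite divr_gt0 ?invr_gt0 ?exprn_gt0 //= ltr_pdivrMr // mul1r.
  by apply: lt_le_trans C_le; rewrite ltr_exp2V; lia.
move=> S [s s_wins].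
have radE n : Defs.radius alpha (2 ^- L / alpha) 1 n = 2 ^- (n * L).
  by rewrite /Defs.radius mulr1 mulrCA divff ?gt_eqF // mulr1 mulnC exprM exprVn.
have [f fP] := choice (fun ny : nat * R => bob_reply_ex j (ny.1 * L + C) N ny.2 j2).
(* Bob starts at 0 with radius 1, so his n-th radius is 2 ^ -(n L) and turns align with blocks of L
   digits. *)
have [x [x0 xS]] := bob_play (s 1 : seq R -> R) (fun n y => f (n, y)) 0.
have [_ outcome] := s_wins 1 x ltr01.
have eL n : (n * L + C + N + 2 = n.+1 * L)%N by rewrite /L; nia.
have [|z zP Sz] := outcome.
  (* Legality: the ball of radius 2 ^ -(n L + C) about Alice's centre lies in her ball, since 2 ^ -C
     <= alpha. *)
  move=> n; rewrite /bob_legal radE -mulrA [_ * 2 ^- (n * L)]mulrC.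
  have [+ _] := fP (n, s 1 (mkseq x n.+1)); rewrite /= -xS eL.
  have -> : alpha * (2 ^- (n * L) * (2 ^- L / alpha)) = 2 ^- (n.+1 * L).
    by rewrite mulSn exprD; field; rewrite !expf_neq0 // gt_eqF.
  move=> h; apply: le_trans h _.
  by rewrite exprD invfM mulrC ler_wpM2r // invr_ge0 exprn_ge0.
exists z => //; apply: (@dense_digit_freq _ z j C (C + N) L) => //.
- by rewrite /L; lia.
- by rewrite /L addn2.
- by rewrite (_ : (C + (L - (C + N)) = C + 2)%N) // /L; lia.
move=> n i /andP[le_Ci lt_i].
have : (\bigcap_n (@cball R R^o (x n) (Defs.radius alpha (2 ^- L / alpha) 1 n) `&`
    @cball R R^o (s 1 (mkseq x n.+1))
      (alpha * Defs.radius alpha (2 ^- L / alpha) 1 n))) z.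
  by rewrite zP.
(* The digits of block n are fixed by Bob's ball of index n + 1. *)
move=> /(_ n.+1 I)[+ _]; rewrite radE /cball /= => z_near.
have [_] := fP (n, s 1 (mkseq x n.+1)); rewrite /= -xS eL.
move=> /(_ z z_near (i - C)%N).
by rewrite -addnA subnKC //; apply; lia.
Qed.

End Strategies.

(* R^o is R as a metric space, with mdist x y = `|y - x|. *)
Theorem theorem2p15 (R : realType) :
  winning [set x : R^o | forall j : 'I_2,
    [/\ 0 < lower_freq (x : R) j,
        lower_freq (x : R) j <= upper_freq (x : R) j &
        upper_freq (x : R) j < 1]] /\
  (forall (eps : R) (j : 'I_2), 0 < eps ->
     ~ winning [set x : R^o | eps < upper_freq (x : R) j] /\
     ~ winning [set x : R^o | lower_freq (x : R) j < 1 - eps]).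
Proof.
split; first exact: positive_freq_winning.
move=> eps j eps0; split=> -[alpha alpha01 win].
  (* Forcing the digit 1 - j leaves j = 1 - (1 - j) with upper frequency at most eps. *)
  have [|beta beta01 forced] := bob_forces_digit alpha eps (1 - j) alpha01 eps0.
    by lia.
  have [z /= gt_eps [_]] := forced _ (win beta beta01).
  by rewrite subKn -1?ltnS // leNgt gt_eps.
have [beta beta01 forced] := bob_forces_digit alpha eps j alpha01 eps0 (ltn_ord j).
have [z /= lt_eps [+ _]] := forced _ (win beta beta01).
by rewrite leNgt lt_eps.
Qed.
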